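(* For any finite group $G$ we have the inequality $$\mathsf{D}(G)>\max\{\mathsf{dcd}(H)\mid H\le G\},$$ where the maximum is over all subgroups $H$ of $G$.
   Context: For a finite group $G$, $\mathcal{F}(G)$ is the free abelian monoid with basis $G$, with operation $\cdot$; its elements are called sequences over $G$ (finite multisets of elements of $G$), and $|S|=\ell$ is the length of $S=g_1\cdot\ldots\cdot g_\ell$. $S$ is a product-one sequence if for some permutation $\pi$ of $\{1,\dots,\ell\}$ we have $g_{\pi(1)}\cdots g_{\pi(\ell)}=1_G$ in $G$; these form a submonoid $\mathcal{B}(G)$ of $\mathcal{F}(G)$. An element $S\in\mathcal{B}(G)$ is an atom if it cannot be written as $S=T\cdot U$ with $T,U\in\mathcal{B}(G)$, $|T|>0$, $|U|>0$. The large Davenport constant $\mathsf{D}(G)$ is the maximal length of an atom in $\mathcal{B}(G)$. For a subset $B$ of a finite group $H$ and $g\in\langle B\rangle$ (the subgroup generated by $B$), $\ell_B(g)$ is the minimal $n\in\mathbb{Z}_{\ge 0}$ such that $g$ is a product of $n$ (not necessarily distinct) elements of $B$ ($\ell_B(1_H)=0$). The directed Cayley diameter of $H$ is $\mathsf{dcd}(H):=\max\{\ell_B(g)\mid g\in H,\ B\subseteq H,\ \langle B\rangle=H\}$. *)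

(* Defs.v *)
From mathcomp Require Import all_boot all_fingroup finmap multiset.
From mathcomp Require Import boolp.

Set Implicit Arguments.
Unset Strict Implicit.
Unset Printing Implicit Defensive.

Local Open Scope group_scope.
Local Open Scope mset_scope.

Section Sequences.
Variable gT : finGroupType.
Implicit Types (G : {group gT}) (S T U : {mset gT}).

(* A sequence is a finite multiset over gT, and its length is [size S];
   multisets coerce to an enumeration (with repetitions) of their elements. *)

Definition sequence_over G S : Prop := {subset S <= G}.

Definition product_one S : Prop :=
  exists2 s : seq gT, perm_eq s S & \prod_(x <- s) x = 1.

(* The empty sequence also satisfies this predicate. This does not affect the
   maximal length of an atom, since [mset 1] is an atom of length 1. *)
Definition is_atom G S : Prop :=
  [/\ sequence_over G S, product_one S &
      ~ exists T U : {mset gT},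
          [/\ sequence_over G T /\ product_one T,
              sequence_over G U /\ product_one U,
              S = T `+` U, 0 < size T & 0 < size U]].

Definition atom_length G : pred nat :=
  fun n => `[< exists2 S, is_atom G S & size S = n >].

Lemma size_msetD T U : size (T `+` U) = size T + size U.
Proof.
rewrite -size_cat; apply: perm_size; apply/allP => x _ /=.
by rewrite count_cat !count_mem_mset msetE2.
Qed.

Lemma atom_length_ex G : exists n, atom_length G n.
Proof.
exists 0; apply/asboolP; exists mset0; last by rewrite enum_mset0.
split; first by move=> x; rewrite in_mset0.
  by exists [::]; rewrite ?enum_mset0 ?big_nil.
case=> T [U [_ _ E]]; have := size_msetD T U.
by rewrite -E enum_mset0; case: (size T).
Qed.

Lemma atom_length_le G n : atom_length G n -> n <= #|G|.
Proof.
case/asboolP=> S [SG [s sS s1] atomS] <-; rewrite leqNgt; apply/negP => ltGS.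
apply: atomS; rewrite -(perm_size sS) in ltGS.
have sG x : x \in s -> x \in G by rewrite (perm_mem sS) => /SG.
pose p (i : 'I_(size s)) := \prod_(x <- take i s) x.
have pG i : p i \in G.
  by rewrite /p big_seq group_prod // => x /mem_take /sG.
have /injectivePn [i0 [j0 ne0 eq0]] : ~~ injectiveb p.
  apply/negP => /injectiveP p_inj.
  have: #|[set p i | i in 'I_(size s)]| <= #|G|.
    by apply/subset_leq_card/subsetP => _ /imsetP[i _ ->].
  by rewrite card_imset // card_ord leqNgt ltGS.
wlog ltij : i0 j0 ne0 eq0 / i0 < j0.
  move=> wlt; have:= ne0; rewrite -val_eqE neq_ltn => /orP[ltij|ltji].
    exact: wlt ne0 eq0 ltij.
  by apply: (wlt j0 i0) ltji; rewrite // eq_sym.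
set i : nat := i0 in ltij *; set j : nat := j0 in ltij *.
have ltjs : j < size s by exact: ltn_ord.
pose a := take i s; pose b := drop i (take j s); pose c := drop j s.
have tja : take j s = a ++ b.
  by rewrite /a /b -(take_takel s (ltnW ltij)) cat_take_drop.
have sabc : s = a ++ b ++ c by rewrite catA -tja cat_take_drop.
have b1 : \prod_(x <- b) x = 1.
  move: eq0; rewrite /p -/i -/j tja big_cat /= -/a -[LHS]mulg1.
  by move/mulgI.
have ac1 : \prod_(x <- a ++ c) x = 1.
  by have:= s1; rewrite {1}sabc !big_cat /= b1 mul1g.
have sub x : x \in a ++ b ++ c -> x \in G by rewrite -sabc; apply: sG.
exists (seq_mset b), (seq_mset (a ++ c)); split.
- split; last by exists b; rewrite // perm_sym perm_eq_seq_mset.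
  move=> x; rewrite (perm_mem (perm_eq_seq_mset _)) => xb.
  by apply: sub; rewrite !mem_cat xb orbT.
- split; last by exists (a ++ c); rewrite // perm_sym perm_eq_seq_mset.
  move=> x; rewrite (perm_mem (perm_eq_seq_mset _)) mem_cat => xac.
  by apply: sub; rewrite !mem_cat orbCA xac orbT.
- apply/msetP => x; rewrite msetE2 !mset_seqE -count_mem_mset.
  by rewrite -(seq.permP sS) sabc !count_cat addnCA.
- by rewrite (perm_size (perm_eq_seq_mset _)) size_drop size_takel ?subn_gt0 // ltnW.
- rewrite (perm_size (perm_eq_seq_mset _)) size_cat size_drop.
  by rewrite addn_gt0 subn_gt0 ltjs orbT.
Qed.

Definition large_davenport G : nat :=
  ex_maxn (atom_length_ex G) (@atom_length_le G).

End Sequences.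

Section CayleyDiameter.
Variable gT : finGroupType.
Implicit Types (B : {set gT}) (H : {group gT}) (g : gT).

(* [B ^+ n] is the set of products of n elements of B, with [B ^+ 0 = [set 1]]. *)
Lemma word_length_ex B g : g \in <<B>> -> exists n, g \in B ^+ n.
Proof.
case/gen_prodgP=> n [c cB ->]; exists n.
elim: n c cB => [|n IHn] c cB; first by rewrite big_ord0 expg0 set11.
by rewrite big_ord_recl expgS mem_mulg // IHn.
Qed.

(* The value is 0, by convention, outside <<B>>. *)
Definition word_length B g : nat :=
  match @idP (g \in <<B>>) with
  | ReflectT gB => ex_minn (word_length_ex gB)
  | ReflectF _ => 0
  end.

Definition dcd H : nat :=
  \max_(B : {set gT} | (B \subset H) && (<<B>> == H :> {set gT}))
    \max_(g in H) word_length B g.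

End CayleyDiameter.

(* Main.v *)
Require Import Defs.
From mathcomp Require Import all_boot all_fingroup.
From mathcomp Require Import finmap multiset boolp.

Set Implicit Arguments.
Unset Strict Implicit.
Unset Printing Implicit Defensive.

(** If [s] is a shortest word over [B] with product [g], then the sequence
    consisting of [g^-1] and the letters of [s] is an atom of length
    [size s + 1]: in a factorization into two product-one sequences, rotating
    the factor containing [g^-1] so that [g^-1] comes first writes [g] as a
    product of fewer letters of [s]. *)

Section ShortestWords.
Local Open Scope group_scope.
Local Open Scope mset_scope.
Variable gT : finGroupType.
Implicit Types (G : {group gT}) (B : {set gT}) (g h x : gT) (s t u : seq gT).

Lemma perm_eq_msetD (T U : {mset gT}) t u :
  perm_eq t T -> perm_eq u U -> perm_eq (t ++ u) (T `+` U).
Proof.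
move=> /seq.permP tT /seq.permP uU; apply/allP => x _ /=.
by rewrite count_cat tT uU !count_mem_mset msetE2.
Qed.

(** Cyclic rotation conjugates the product, so a product-one word keeps product one when [h] is
    brought to the front. *)
Lemma prod1_rot_mem h u :
  h \in u -> \prod_(x <- u) x = 1 ->
  exists2 v, perm_eq u (h :: v) & \prod_(x <- v) x = h^-1.
Proof.
case/splitPr=> u1 u2; rewrite big_cat big_cons /= => u_prod1.
exists (u2 ++ u1); first by rewrite perm_catC.
rewrite big_cat /=; apply: (mulgI h); rewrite mulgV.
apply: (mulgI (\prod_(x <- u1) x)).
by rewrite !mulgA -(mulgA _ h) u_prod1 mul1g mulg1.
Qed.

(** Competitors use only letters of [s], so no generating set [B] has to be mentioned; a subword of
    a permutation of [s] always qualifies. *)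
Definition shortest_word s : Prop :=
  forall t, {subset t <= s} -> \prod_(x <- t) x = \prod_(x <- s) x ->
    size s <= size t.

Lemma shortest_word_no_split s t u :
    shortest_word s -> perm_eq ((\prod_(x <- s) x)^-1 :: s) (t ++ u) ->
    \prod_(x <- u) x = 1 -> (\prod_(x <- s) x)^-1 \in u ->
  size t = 0.
Proof.
move=> s_min; set h := _^-1 => s_tu u1 hu.
have [v uv prod_v] := prod1_rot_mem hu u1.
have stv : perm_eq s (t ++ v).
  rewrite -(perm_cons h) (perm_trans s_tu) //.
  by rewrite (perm_trans (perm_cat (perm_refl t) uv)) // (perm_catCA t [:: h]).
have vs : {subset v <= s}.
  by move=> x xv; rewrite (perm_mem stv) mem_cat xv orbT.
(* Minimality against [v] reads [size t + size v <= size v]. *)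
have:= s_min v vs; rewrite prod_v invgK (perm_size stv) size_cat.
by move/(_ erefl); rewrite -[leqRHS]add0n leq_add2r leqn0 => /eqP.
Qed.

Lemma shortest_word_atom G s :
    {subset s <= G} -> shortest_word s ->
  is_atom G (seq_mset ((\prod_(x <- s) x)^-1 :: s)).
Proof.
move=> sG s_min; set h := _^-1; set S := seq_mset _.
have SE : perm_eq (h :: s) S by rewrite perm_sym perm_eq_seq_mset.
split; first 2 last.
- case=> T [U [[_ [t tT t1]] [_ [u uU u1]] S_TU]].
  rewrite -(perm_size tT) -(perm_size uU) => t_gt0 u_gt0.
  have s_tu : perm_eq (h :: s) (t ++ u).
    by rewrite (perm_trans SE) // S_TU perm_sym perm_eq_msetD.
  have: h \in t ++ u by rewrite -(perm_mem s_tu) mem_head.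
  (* Whichever factor contains [h], the other one is forced to be empty. *)
  rewrite mem_cat => /orP[ht | hu].
    rewrite perm_sym perm_catC perm_sym in s_tu.
    by rewrite (shortest_word_no_split s_min s_tu t1 ht) in u_gt0.
  by rewrite (shortest_word_no_split s_min s_tu u1 hu) in t_gt0.
- move=> x; rewrite -(perm_mem SE) inE => /predU1P[-> | /sG //].
  by rewrite groupV big_seq group_prod.
- by exists (h :: s); rewrite // big_cons mulVg.
Qed.

Lemma leq_large_davenport G (S : {mset gT}) :
  is_atom G S -> size S <= large_davenport G.
Proof.
move=> atomS; rewrite /large_davenport; case: ex_maxnP => n _; apply.
by apply/asboolP; exists S.
Qed.

Lemma mem_expg_setP B n g :
  reflect (exists s, [/\ size s = n, {subset s <= B} & \prod_(x <- s) x = g])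
          (g \in B ^+ n).
Proof.
elim: n g => [|n IHn] g.
  rewrite expg0; apply: (iffP set1P) => [-> | [s [/size0nil-> _ <-]]].
    by exists [::]; rewrite big_nil.
  by rewrite big_nil.
rewrite expgS; apply: (iffP mulsgP) => [[x y xB /IHn[s [<- sB <-]] ->]|].
  exists (x :: s); split; rewrite ?big_cons //.
  by move=> z; rewrite inE => /predU1P[-> | /sB].
case=> [[|x s]] [] //= [sn] sB <-; rewrite big_cons.
exists x (\prod_(y <- s) y) => //; first by rewrite sB ?mem_head.
by apply/IHn; exists s; split=> // y ys; rewrite sB // inE ys orbT.
Qed.

Lemma word_length_shortest B g :
    g \in <<B>> ->
  exists s, [/\ size s = word_length B g, {subset s <= B} & shortest_word s].
Proof.
(* The default value 0 is taken only outside [<<B>>], a case excluded here. *)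
rewrite /word_length; case: {1}_ / idP => // gB _.
case: ex_minnP => n /mem_expg_setP[s [sn sB sg]] n_min.
exists s; split=> // t ts; rewrite sg sn => tg.
by apply/n_min/mem_expg_setP; exists t; split=> // x /ts/sB.
Qed.

Lemma word_length_lt_davenport G B g :
  B \subset G -> g \in <<B>> -> word_length B g < large_davenport G.
Proof.
move=> /subsetP sBG /word_length_shortest[s [<- sB s_min]].
have sG : {subset s <= G} by move=> x /sB/sBG.
have:= leq_large_davenport (shortest_word_atom sG s_min).
(* The extra letter, the inverse of the product, makes the inequality strict. *)
by rewrite (perm_size (perm_eq_seq_mset _)).
Qed.

End ShortestWords.

Theorem corollary4p3 (gT : finGroupType) (G : {group gT}) :
  \max_(H : {group gT} | H \subset G) dcd H < large_davenport G.
Proof.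
(* Positivity lets the strict bound be restated as [<=] the predecessor, the form that [bigmax_leqP]
   handles. *)
have D_gt0 : 0 < large_davenport G.
  exact: leq_ltn_trans (word_length_lt_davenport (subxx G) (group1 _)).
rewrite -(prednK D_gt0) ltnS; apply/bigmax_leqP => H sHG.
apply/bigmax_leqP => B /andP[sBH /eqP genB]; apply/bigmax_leqP => g gH.
(* A generating set of [H] is also a subset of [G], so the bound applies in [G] directly, without
   comparing Davenport constants. *)
rewrite -ltnS prednK // word_length_lt_davenport ?genB //.
exact: subset_trans sBH sHG.
Qed.
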